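(* The family $E_{3b}=E_{3b}(e_1,e_3,e_5,e_6)$ admits a shift operator for each of the shifts $e_i\to e_i\pm2$ ($i=1,3,5$) and $e_6\to e_6\pm1$, where in each case the other three of the free parameters $e_1,e_3,e_5,e_6$ are kept fixed.
   Context: Let $\partial=d/dx$ and $D=\mathbb{C}(x)[\partial]$. The operator $E_3(e)$: for $e=(e_1,\dots,e_7)$ with $e_1+\cdots+e_7=3$, put $$E_3(e)=x^2(x-1)^2\partial^3+x(x-1)(a_{21}x+a_{20})\partial^2+(a_{12}x^2+a_{11}x+a_{10})\partial+a_{01}x+A_{00}(e),$$ where $a_{21}=6-e_1-e_2-e_3-e_4$, $a_{20}=-3+e_1+e_2$, $a_{12}=(e_5+e_6+1)e_7+(e_6+1)(e_5+1)$, $a_{11}=-(e_5+e_6)e_7-e_1e_2+e_3e_4-e_5e_6+2e_1+2e_2-4$, $a_{10}=(e_1-1)(e_2-1)$, $a_{01}=e_5e_6e_7$, and $$\begin{aligned}54A_{00}(e)=&-4(e_1+e_2-e_3-e_4)^3-27e_5e_6e_7+9(e_1+e_2-e_3-e_4)(e_5e_6+e_5e_7+e_6e_7-2)\\&+9e_1e_2(e_1+e_2-1)+18(e_1+e_2-1)(e_3^2+e_3e_4+e_4^2)\\&-9e_3e_4(e_3+e_4-1)-18(e_3+e_4-1)(e_1^2+e_1e_2+e_2^2).\end{aligned}$$ $E_{3b}(e_1,e_3,e_5,e_6)$ is the specialization of $E_3(e)$ by $e_2=-e_3-e_5-2e_6+3-e_1$, $e_4=e_3-e_5+e_6$ (and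 $e_7=3-(e_1+\cdots+e_6)$). Shift operators: let $E(p)$ be a family of third-order operators depending on parameters $p$, irreducible for generic $p$, and let $p\to p_+$ be a shift of the parameters by integers. A shift operator for this shift is a non-zero operator $P\in D$ of order lower than $3$, depending on $p$, sending the solution space of $E(p)$ to the solution space of $E(p_+)$; equivalently, there is $Q\in D$ with $E(p_+)\circ P=Q\circ E(p)$. The parameters are regarded as generic (indeterminates); the coefficients of $P$ are rational functions of $x$ and of $p$ (poles in $x$ are allowed; after normalization they may be taken polynomial in $p$ without common factor). *)

(* Defs.v *)
From HB Require Import structures.
From mathcomp Require Import all_boot all_order all_algebra.
From mathcomp Require Import fraction complex reals mpoly ring.
Set Implicit Arguments.
Unset Strict Implicit.
Unset Printing Implicit Defensive.
Import GRing.Theory.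
Local Open Scope ring_scope.
Local Open Scope quotient_scope.

Notation "x %:F" := (@FracField.tofrac _ x) : ring_scope.

(* d/dx on K(x), by the quotient rule applied to a representative n / d;
   [fderivE] shows that the choice of representative is irrelevant. *)
Definition fderiv (K : fieldType) (f : {fraction {poly K}}) :
    {fraction {poly K}} :=
  let n := \n_(repr f) in
  let d := \d_(repr f) in
  (n^`() * d - n * d^`())%:F / (d ^+ 2)%:F.

(* Over a field F with derivation [d], the polynomial \sum_i P`_i *: 'X^i in
   {poly F} encodes the differential operator \sum_i P`_i \partial^i, with
   coefficients on the left.  Its order is (size P).-1.  The commutative ring
   product of {poly F} is not the composition of operators, which is [dcomp]. *)

(* \partial o Q = \sum_j (Q_j \partial^(j+1) + d(Q_j) \partial^j) *)
Definition dleft (F : fieldType) (d : F -> F) (Q : {poly F}) : {poly F} :=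
  Q * 'X + map_poly d Q.

Definition dcomp (F : fieldType) (d : F -> F) (P Q : {poly F}) : {poly F} :=
  \sum_(i < size P) P`_i *: iter i (dleft d) Q.

Definition dapp (F : fieldType) (d : F -> F) (P : {poly F}) (f : F) : F :=
  \sum_(i < size P) P`_i * iter i d f.

Lemma fderivE (K : fieldType) (n d : {poly K}) : d != 0 ->
  fderiv (n%:F / d%:F) = (n^`() * d - n * d^`())%:F / (d ^+ 2)%:F.
Proof.
move=> d0; rewrite /fderiv; set f := n%:F / d%:F.
have d1 : \d_(repr f) != 0 by exact: denom_ratioP.
have fE : f = (\n_(repr f))%:F / (\d_(repr f))%:F.
  rewrite -[LHS]reprK -[repr f in LHS]Ratio_numden.
  move: (\n_(repr f)) (\d_(repr f)) d1 => a b b0.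
  apply/(mulIf (x := b%:F)); first by rewrite tofrac_eq0.
  rewrite divfK ?tofrac_eq0 //; unlock FracField.tofrac.
  rewrite -[LHS]FracField.pi_mul; apply/eqmodP => /=.
  rewrite FracField.equivfE /FracField.mulf !numden_Ratio ?oner_neq0 ?mulr1 //.
  by rewrite mulrC.
move: (\n_(repr f)) (\d_(repr f)) d1 fE => a b b0 fE.
have /eqP : n%:F / d%:F = a%:F / b%:F.
  by rewrite -fE.
rewrite eqr_div ?tofrac_eq0 // -2!tofracM tofrac_eq => /eqP nb.
have dnb : n^`() * b + n * b^`() = a^`() * d + a * d^`() by rewrite -!derivM nb.
apply/eqP; rewrite eqr_div ?tofrac_eq0 ?expf_neq0 // -2!tofracM tofrac_eq.
rewrite -subr_eq0.
have -> : (a^`() * b - a * b^`()) * d ^+ 2 - (n^`() * d - n * d^`()) * b ^+ 2 =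
    (n * b - a * d) * (d^`() * b + d * b^`())
    - b * d * ((n^`() * b + n * b^`()) - (a^`() * d + a * d^`())) by ring.
by rewrite nb dnb !subrr mul0r mulr0 subr0.
Qed.

Lemma dapp_wide (F : fieldType) (d : F -> F) (P : {poly F}) (f : F) m :
  (size P <= m)%N -> dapp d P f = \sum_(i < m) P`_i * iter i d f.
Proof.
move=> sPm; rewrite /dapp (big_ord_widen m (fun i => P`_i * iter i d f)) //.
rewrite big_mkcond; apply: eq_bigr => i _; case: ltnP => // sPi.
by rewrite nth_default // mul0r.
Qed.

Lemma dapp_comp (F : fieldType) (d : F -> F) (P Q : {poly F}) (f : F) :
    (forall a b, d (a + b) = d a + d b) ->
    (forall a b, d (a * b) = d a * b + a * d b) ->
  dapp d (dcomp d P Q) f = dapp d P (dapp d Q f).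
Proof.
move=> dD dM.
have d0 : d 0 = 0 by apply: (@addrI _ (d 0)); rewrite -dD !addr0.
have dappD A B : dapp d (A + B) f = dapp d A f + dapp d B f.
  rewrite !(@dapp_wide _ d _ f (maxn (size A) (size B))) ?leq_maxl ?leq_maxr ?size_polyD //.
  by rewrite -big_split; apply: eq_bigr => i _; rewrite coefD mulrDl.
have dapp0 : dapp d 0 f = 0 by rewrite /dapp size_poly0 big_ord0.
have dappZ c A : dapp d (c *: A) f = c * dapp d A f.
  rewrite (@dapp_wide _ d (c *: A) f (size A)) ?size_scale_leq // mulr_sumr.
  by apply: eq_bigr => i _; rewrite coefZ mulrA.
have dappL A : dapp d (dleft d A) f = d (dapp d A f).
  rewrite /dleft dappD (@dapp_wide _ d (A * 'X) f (size A).+1); last first.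
    by apply: leq_trans (size_polyMleq _ _) _; rewrite size_polyX addn2.
  rewrite big_ord_recl coefMX eqxx mul0r add0r.
  rewrite (@dapp_wide _ d (map_poly d A) f (size A)) ?size_poly //.
  rewrite /dapp (big_morph d dD d0) addrC -big_split; apply: eq_bigr => i _ /=.
  by rewrite coefMX coef_map_id0 // dM.
rewrite /dcomp (big_morph (fun A => dapp d A f) dappD dapp0).
apply: eq_bigr => i _; rewrite dappZ; congr (_ * _).
by elim: (i : nat) => //= k IH; rewrite dappL IH.
Qed.

(* [P] intertwines the third-order operators [E] and [Ep]: it maps the solutions
   of E to solutions of Ep. *)
Definition is_shift_operator (K : fieldType)
    (E Ep P : {poly {fraction {poly K}}}) : Prop :=
  [/\ P != 0, (size P <= 3)%N
    & exists Q, dcomp (@fderiv K) Ep P = dcomp (@fderiv K) Q E].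

(* The parameters are meant to satisfy e1 + ... + e7 = 3. *)
Definition A00 (K : fieldType) (e1 e2 e3 e4 e5 e6 e7 : K) : K :=
  (- 4 * (e1 + e2 - e3 - e4) ^+ 3 - 27 * e5 * e6 * e7
   + 9 * (e1 + e2 - e3 - e4) * (e5 * e6 + e5 * e7 + e6 * e7 - 2)
   + 9 * e1 * e2 * (e1 + e2 - 1)
   + 18 * (e1 + e2 - 1) * (e3 ^+ 2 + e3 * e4 + e4 ^+ 2)
   - 9 * e3 * e4 * (e3 + e4 - 1)
   - 18 * (e3 + e4 - 1) * (e1 ^+ 2 + e1 * e2 + e2 ^+ 2)) / 54.

Definition E3 (K : fieldType) (e1 e2 e3 e4 e5 e6 e7 : K) :
    {poly {fraction {poly K}}} :=
  let x : {fraction {poly K}} := 'X%:F in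
  let cst (a : K) : {fraction {poly K}} := (a%:P)%:F in
  let a21 := 6 - e1 - e2 - e3 - e4 in
  let a20 := - 3 + e1 + e2 in
  let a12 := (e5 + e6 + 1) * e7 + (e6 + 1) * (e5 + 1) in
  let a11 := - (e5 + e6) * e7 - e1 * e2 + e3 * e4 - e5 * e6
             + 2 * e1 + 2 * e2 - 4 in
  let a10 := (e1 - 1) * (e2 - 1) in
  let a01 := e5 * e6 * e7 in
  (x ^+ 2 * (x - 1) ^+ 2) *: 'X^3
  + (x * (x - 1) * (cst a21 * x + cst a20)) *: 'X^2
  + (cst a12 * x ^+ 2 + cst a11 * x + cst a10) *: 'X
  + (cst a01 * x + cst (A00 e1 e2 e3 e4 e5 e6 e7))%:P.

Definition E3b (K : fieldType) (e1 e3 e5 e6 : K) :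
    {poly {fraction {poly K}}} :=
  let e2 := - e3 - e5 - 2 * e6 + 3 - e1 in
  let e4 := e3 - e5 + e6 in
  let e7 := 3 - (e1 + e2 + e3 + e4 + e5 + e6) in
  E3 e1 e2 e3 e4 e5 e6 e7.

(* C(p_0, ..., p_3), with C = R[i] the complex numbers. *)
Definition param_field (R : realType) : fieldType :=
  {fraction {mpoly R[i][4]}}.

Definition param (R : realType) (k : nat) : param_field R :=
  ('X_(inord k : 'I_4) : {mpoly R[i][4]})%:F.

(* The family [E], taken at four indeterminate parameters, admits a shift
   operator when these are shifted by (n0, n1, n2, n3). *)
Definition admits_shift (R : realType)
    (E : forall K : fieldType, K -> K -> K -> K -> {poly {fraction {poly K}}})
    (n0 n1 n2 n3 : int) : Prop :=
  let p := param R in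
  exists P : {poly {fraction {poly param_field R}}},
    is_shift_operator
      (E _ (p 0%N) (p 1%N) (p 2%N) (p 3%N))
      (E _ (p 0%N + n0%:~R) (p 1%N + n1%:~R)
           (p 2%N + n2%:~R) (p 3%N + n3%:~R))
      P.

(* Main.v *)
(* E3b is a pullback of the hypergeometric equation 3F2(a1, a2, a3; b1, b2; z)
   with b1 + b2 = a1 + a2 + a3 + 1/2.  The latter has exponents 0, 1/2, 1 at z = 1,
   so that a double covering x -> z = - x^2 / (4 (1 - x)) branched over 0 and 1
   makes x = 2 an ordinary point, and E3b results after multiplying the solutions
   by (1 - x)^(- e7/2).  The shifts of the statement become integer shifts of the
   a's and b's, realised by contiguity operators z^-1 pm(theta) + p0(theta) +
   z p1(theta) with theta = z d/dz; since p(theta) z = z p(theta + 1), their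
   intertwining property is a system of identities between polynomials in one
   variable.  Identities between operators are checked on functions, an operator
   being determined by its action on the powers of x. *)
Require Import Defs.
From mathcomp Require Import all_boot all_order all_algebra.
From mathcomp Require Import fraction complex reals mpoly.
From mathcomp Require Import ring.
Set Implicit Arguments.
Unset Strict Implicit.
Unset Printing Implicit Defensive.
Import GRing.Theory.
Local Open Scope ring_scope.

(** * Differential operators seen through their action on functions *)

Section DifferentialOperators.
Variables (F : fieldType) (d : F -> F).
Hypothesis dD : forall a b, d (a + b) = d a + d b.
Hypothesis dM : forall a b, d (a * b) = d a * b + a * d b.

Lemma deriv0 : d 0 = 0.
Proof. by apply: (@addrI _ (d 0)); rewrite -dD !addr0. Qed.

Lemma deriv1 : d 1 = 0.
Proof. by apply: (@addrI _ (d 1)); rewrite addr0 -{3}[1]mulr1 dM mulr1 mul1r. Qed.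

Lemma derivN a : d (- a) = - d a.
Proof. by apply/eqP; rewrite -addr_eq0 -dD addNr deriv0. Qed.

Lemma derivV a : a != 0 -> d a^-1 = - d a / a ^+ 2.
Proof.
move=> a0; apply: (mulfI a0); apply: (@addrI _ (d a * a^-1)).
by rewrite -dM divff // deriv1; field.
Qed.

Lemma dappDl A B f : dapp d (A + B) f = dapp d A f + dapp d B f.
Proof.
rewrite !(@dapp_wide _ d _ f (maxn (size A) (size B))) ?leq_maxl ?leq_maxr ?size_polyD //.
by rewrite -big_split; apply: eq_bigr => i _; rewrite coefD mulrDl.
Qed.

Lemma dappZl c A f : dapp d (c *: A) f = c * dapp d A f.
Proof.
rewrite (@dapp_wide _ d (c *: A) f (size A)) ?size_scale_leq // mulr_sumr.
by apply: eq_bigr => i _; rewrite coefZ mulrA.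
Qed.

Lemma dapp_Xn n f : dapp d 'X^n f = iter n d f.
Proof.
rewrite /dapp size_polyXn big_ord_recr /= big1 ?add0r.
  by rewrite coefXn eqxx mul1r.
by move=> i _; rewrite coefXn ltn_eqF // mul0r.
Qed.

Lemma dappX f : dapp d 'X f = d f.
Proof. exact: (dapp_Xn 1). Qed.

Lemma dappC a f : dapp d a%:P f = a * f.
Proof. by rewrite -[a%:P]mulr1 mul_polyC dappZl (dapp_Xn 0). Qed.

Variable x : F.
Hypothesis dx : d x = 1.
Hypothesis F0 : [pchar F] =i pred0.

Lemma deriv_iter_Xn k i : iter i d (x ^+ k) = x ^+ (k - i) *+ k ^_ i.
Proof.
have dMn a n : d (a *+ n) = d a *+ n.
  by elim: n => [|n IH]; rewrite ?mulr0n ?deriv0 // !mulrS dD IH.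
have dX n : d (x ^+ n) = x ^+ n.-1 *+ n.
  elim: n => [|n IH]; first by rewrite deriv1.
  rewrite exprS dM dx mul1r IH /= mulrnAr -exprS; case: n {IH} => [|n] //=.
  by rewrite addr0.
elim: i => [|i IH]; first by rewrite subn0 ffactn0.
by rewrite iterS IH dMn dX -mulrnA subnS ffactnSr mulnC.
Qed.

(* An operator killing 1, x, x^2, ... vanishes: the lowest coefficient that is
   not yet known to be 0 is isolated by the matching power of x. *)
Lemma dapp_inj A B : (forall f, dapp d A f = dapp d B f) -> A = B.
Proof.
move=> eqAB; apply/eqP; rewrite -subr_eq0; apply/eqP.
have {eqAB} C0 f : dapp d (A - B) f = 0.
  by rewrite dappDl -scaleN1r dappZl eqAB mulN1r subrr.
move: (A - B) C0 => C C0; apply/polyP => k; rewrite coef0.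
elim/ltn_ind: k => k IH.
have := C0 (x ^+ k).
rewrite (@dapp_wide _ d C _ (maxn (size C) k.+1)) ?leq_maxl //.
rewrite (bigD1 (Ordinal (leq_maxr (size C) k.+1))) //= big1 ?addr0 => [|i].
  rewrite deriv_iter_Xn subnn expr0 ffactnn => /eqP.
  rewrite mulf_eq0 (proj1 (pcharf0P F) F0) eqn0Ngt fact_gt0 orbF.
  by move/eqP.
rewrite -val_eqE /= neq_ltn => /orP[/IH->|ki]; first by rewrite mul0r.
by rewrite deriv_iter_Xn ffact_small // mulr0n mulr0.
Qed.

(** The coefficient [a] of \partial^n may be 0. It is tracked because the coefficient of order 2
    later certifies that the shift operator is non-zero. *)
Definition is_dop n (g : F -> F) (a : F) :=
  exists P : {poly F}, [/\ (size P <= n.+1)%N, P`_n = a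
    & forall f, dapp d P f = g f].

Lemma is_dop_ext n g g' a : g =1 g' -> is_dop n g a -> is_dop n g' a.
Proof. by move=> gg' [P [sP Pn dP]]; exists P; split=> // f; rewrite dP gg'. Qed.

Lemma is_dop_mul b : is_dop 0 (fun f => b * f) b.
Proof.
by exists b%:P; split=> [||f]; rewrite ?size_polyC_leq1 ?coefC ?dappC.
Qed.

Lemma is_dopZ n g a b : is_dop n g a -> is_dop n (fun f => b * g f) (b * a).
Proof.
case=> P [sP Pn dP]; exists (b *: P); split=> [||f].
- exact: leq_trans (size_scale_leq _ _) sP.
- by rewrite coefZ Pn.
- by rewrite dappZl dP.
Qed.

Lemma is_dopD n g g' a a' : is_dop n g a -> is_dop n g' a' ->
  is_dop n (fun f => g f + g' f) (a + a').
Proof.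
move=> [P [sP Pn dP]] [P' [sP' Pn' dP']]; exists (P + P'); split=> [||f].
- by apply: leq_trans (size_polyD _ _) _; rewrite geq_max sP.
- by rewrite coefD Pn Pn'.
- by rewrite dappDl dP dP'.
Qed.

Lemma is_dopS n g a : is_dop n g a -> is_dop n.+1 g 0.
Proof.
by case=> P [sP _ dP]; exists P; split=> //; rewrite ?nth_default // ltnW.
Qed.

Lemma is_dop_deriv n g a : is_dop n g a -> is_dop n.+1 (fun f => d (g f)) a.
Proof.
case=> P [sP Pn dP]; exists (dleft d P); split=> [||f].
- rewrite /dleft; apply: leq_trans (size_polyD _ _) _; rewrite geq_max.
  apply/andP; split; last by rewrite (leq_trans (size_poly _ _)) // ltnW.
  by rewrite (leq_trans (size_polyMleq _ _)) // size_polyX addn2.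
- rewrite /dleft coefD coefMX /= coef_map_id0 ?deriv0 //.
  by rewrite [P`_n.+1]nth_default // deriv0 addr0.
- have -> : dleft d P = dcomp d 'X P.
    by rewrite /dcomp size_polyX big_ord_recl big_ord1 !coefX scale0r add0r scale1r.
  by rewrite dapp_comp // dP dappX.
Qed.

End DifferentialOperators.

(* [pop c D p] is the operator p(D), for a polynomial p whose coefficients are
   viewed in F through c and are meant to commute with D. *)
Definition pop (K F : fieldType) (c : K -> F) (D : F -> F) (p : {poly K}) f :=
  \sum_(i < size p) c p`_i * iter i D f.

Definition shiftp (K : fieldType) k (p : {poly K}) := p \Po ('X + k%:P).

(** * Polynomials in a linear operator *)

Section PolynomialsInAnOperator.
Variables (K F : fieldType) (c : {rmorphism K -> F}) (D : F -> F).
Hypothesis DD : forall f g, D (f + g) = D f + D g.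
Hypothesis DZ : forall a f, D (c a * f) = c a * D f.

Local Notation op := (pop c D).

Lemma pop_wide (p : {poly K}) f m : (size p <= m)%N ->
  op p f = \sum_(i < m) c p`_i * iter i D f.
Proof.
move=> spm; rewrite /pop (big_ord_widen m (fun i => c p`_i * iter i D f)) //.
rewrite big_mkcond; apply: eq_bigr => i _; case: ltnP => // sPi.
by rewrite nth_default // rmorph0 mul0r.
Qed.

Lemma popDl (p q : {poly K}) f : op (p + q) f = op p f + op q f.
Proof.
rewrite !(@pop_wide _ f (maxn (size p) (size q))) ?leq_maxl ?leq_maxr ?size_polyD //.
by rewrite -big_split; apply: eq_bigr => i _; rewrite coefD rmorphD mulrDl.
Qed.

Lemma pop0 f : op 0 f = 0.
Proof. by rewrite /pop size_poly0 big_ord0. Qed.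

Lemma popC a f : op a%:P f = c a * f.
Proof.
by rewrite (@pop_wide _ f 1) ?size_polyC_leq1 // big_ord1 coefC.
Qed.

Lemma D_sum n (g : 'I_n -> F) : D (\sum_i g i) = \sum_i D (g i).
Proof.
apply: (big_morph D DD).
by have := DZ 0 0; rewrite rmorph0 !mul0r.
Qed.

Lemma popMX (p : {poly K}) f : op (p * 'X) f = D (op p f).
Proof.
rewrite (@pop_wide _ f (size p).+1); last first.
  by rewrite (leq_trans (size_polyMleq _ _)) // size_polyX addn2.
rewrite big_ord_recl coefMX rmorph0 mul0r add0r /pop D_sum.
by apply: eq_bigr => i _; rewrite coefMX DZ.
Qed.

Lemma popDr p f g : op p (f + g) = op p f + op p g.
Proof.
elim/poly_ind: p => [|p a IH]; first by rewrite !pop0 addr0.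
by rewrite !popDl !popMX !popC IH DD mulrDr addrACA.
Qed.

Lemma popZ p a f : op p (c a * f) = c a * op p f.
Proof.
elim/poly_ind: p => [|p b IH]; first by rewrite !pop0 mulr0.
by rewrite !popDl !popMX !popC IH DZ mulrDr [c b * _]mulrCA.
Qed.

(** Since [D] commutes with the constants [c a], operators p(D) compose as commutative polynomials
    multiply. *)
Lemma popM p q f : op (p * q) f = op p (op q f).
Proof.
elim/poly_ind: p => [|p a IH]; first by rewrite mul0r !pop0.
rewrite mulrDl mulrAC !popDl !popMX !popC IH; congr (_ + _).
elim/poly_ind: q {IH} => [|q b IH]; first by rewrite mulr0 !pop0 mulr0.
by rewrite mulrDr mulrA -polyCM !popDl !popMX !popC IH DZ rmorphM mulrDr mulrA.
Qed.

Lemma popX f : op 'X f = D f.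
Proof. by rewrite -['X]mul1r popMX popC rmorph1 mul1r. Qed.

Lemma popXD a f : op ('X + a%:P) f = D f + c a * f.
Proof. by rewrite popDl popC popX. Qed.

Lemma pop_intertwine D' h p f : (forall g, D' (h * g) = h * D g) ->
  pop c D' p (h * f) = h * op p f.
Proof.
move=> D'h; have iterD' i : iter i D' (h * f) = h * iter i D f.
  by elim: i => //= i ->.
by rewrite /pop mulr_sumr; apply: eq_bigr => i _; rewrite iterD' mulrCA.
Qed.

(** The hypothesis says that conjugation by [w] turns D into D + k. With w = z and w = z^-1 this
    carries powers of z to the left of polynomials in theta. *)
Lemma pop_skew w k p f : (forall g, D (w * g) = w * (D g + c k * g)) ->
  op p (w * f) = w * op (shiftp k p) f.
Proof.
move=> Dw; rewrite /shiftp; elim/poly_ind: p => [|p a IH].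
  by rewrite comp_poly0 !pop0 mulr0.
rewrite comp_polyD comp_polyM comp_polyX comp_polyC.
rewrite !popDl !popC popMX IH Dw.
by rewrite [_ * ('X + _)]mulrDr popDl popMX [_ * k%:P]mulrC popM popC [RHS]mulrDr [c a * _]mulrCA.
Qed.

End PolynomialsInAnOperator.

(* With theta = z d/dz, the operator hA(theta) - z hB(theta) annihilates
   3F2(a1, a2, a3; b1, b2; z). *)
Definition hA (K : fieldType) (b1 b2 : K) : {poly K} :=
  'X * ('X + (b1 - 1)%:P) * ('X + (b2 - 1)%:P).

Definition hB (K : fieldType) (a1 a2 a3 : K) : {poly K} :=
  ('X + a1%:P) * ('X + a2%:P) * ('X + a3%:P).

(* These are the coefficients of the powers z^-1, ..., z^2 in
   (A' - z B') (z^-1 pm + p0 + z p1) = (z^-1 qm + q0 + z q1) (A - z B),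
   where p(theta) z^k = z^k p(theta + k). *)
Definition contiguous (K : fieldType) (A B A' B' : {poly K}) :=
  exists pm p0 p1 qm q0 q1 : {poly K},
  [/\ shiftp (-1) A' * pm = qm * A,
      A' * p0 - shiftp (-1) B' * pm = q0 * A - shiftp 1 qm * B,
      shiftp 1 A' * p1 - B' * p0 = q1 * A - shiftp 1 q0 * B,
      shiftp 1 B' * p1 = shiftp 1 q1 * B &
      [/\ (size pm <= 3)%N, (size p0 <= 3)%N, (size p1 <= 3)%N
        & [|| pm`_2 != 0, p0`_2 != 0 | p1`_2 != 0]]].

(** * Explicit contiguity relations *)

Section Contiguity.
Variable K : fieldType.
Implicit Types a b c : K.

Definition quad a b c : {poly K} := a%:P * 'X^2 + b%:P * 'X + c%:P.

Lemma quadE a b c : quad a b c = Poly [:: c; b; a].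
Proof. by rewrite /quad /= !cons_poly_def mul0r add0r; ring. Qed.

Lemma size_quad a b c : (size (quad a b c) <= 3)%N.
Proof. by rewrite quadE (leq_trans (size_Poly _)). Qed.

Lemma quad_coef2 a b c : (quad a b c)`_2 = a.
Proof. by rewrite quadE coef_Poly. Qed.

Ltac poly_identity :=
  rewrite /shiftp /hA /hB /quad
    ?(comp_polyM, comp_polyD, comp_polyX, comp_polyC, comp_Xn_poly); ring.

(* In the next five lemmas the outer two identities of [contiguous] force pm, qm,
   p1, q1 up to scalars, and the inner two are then solved for p0 and q0. *)
Lemma contiguous_a2b2_up a1 a2 a3 b1 b2 :
  contiguous (hA b1 b2) (hB a1 a2 a3) (hA b1 (b2 + 1)) (hB a1 (a2 + 1) a3).
Proof.
(* In factored form, [pm] is X (X + b1 - 1) and [p0] is - (X + a2) (X + a1 + a3 - b2). *)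
exists (quad 1 (b1 - 1) 0), (quad (-1) (b2 - a1 - a3 - a2) (a2 * (b2 - a1 - a3))), 0,
  (quad 1 (b1 - 3) (2 - b1)),
  (quad (-1) (b2 + 1 - a1 - a3 - a2) (a2 * (b2 + 1 - a1 - a3))), 0.
split; last by split; rewrite ?size_quad ?size_poly0 // quad_coef2 oner_eq0.
all: poly_identity.
Qed.

Lemma contiguous_a2b2_down a1 a2 a3 b1 b2 :
  contiguous (hA b1 b2) (hB a1 a2 a3) (hA b1 (b2 - 1)) (hB a1 (a2 - 1) a3).
Proof.
(* In factored form, [p0] is - (X + b2 - 1) (X + b1 - a2) and [p1] is (X + a1) (X + a3). *)
exists 0, (quad (-1) (a2 - b1 + 1 - b2) ((a2 - b1) * (b2 - 1))),
  (quad 1 (a1 + a3) (a1 * a3)), 0,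
  (quad (-1) (a2 - b1 + 2 - b2) ((a2 - b1) * (b2 - 2))),
  (quad 1 (a1 + a3) (a1 * a3)).
split; last by split; rewrite ?size_quad ?size_poly0 // !quad_coef2 oppr_eq0 oner_eq0 orbT.
all: poly_identity.
Qed.

Lemma contiguous_b1_down_b2_up a1 a2 a3 b1 b2 : b1 - b2 - 1 != 0 ->
  contiguous (hA b1 b2) (hB a1 a2 a3) (hA (b1 - 1) (b2 + 1)) (hB a1 a2 a3).
Proof.
pose c := b1 - b2 - 1; rewrite -/c => c0.
(* Dividing [hB a1 a2 a3] by X + b2 gives the quotient g = X^2 + g1 X + g0 and the remainder [h].
   Then [p0] is h - c g, and [q0] is [p0] taken at X - 1. *)
pose h := (a1 - b2) * (a2 - b2) * (a3 - b2).
pose s1 := a1 + a2 + a3; pose s2 := a1 * a2 + a1 * a3 + a2 * a3.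
pose g1 := s1 - b2; pose g0 := s2 - b2 * s1 + b2 ^+ 2.
exists (quad c (c * (b1 - 1)) 0), (quad (- c) (- c * g1) (h - c * g0)), 0,
  (quad c (c * (b1 - 4)) (c * (3 - b1))),
  (quad (- c) (- c * (g1 - 2)) (h - c * (g0 - g1 + 1))), 0.
split; last by split; rewrite ?size_quad ?size_poly0 // quad_coef2 c0.
all: rewrite /g1 /g0 /s1 /s2 /h /c; poly_identity.
Qed.

Lemma contiguous_a1a2b2_up_a3_down a1 a2 a3 b1 b2 : (1 - a3) * (b1 - a3) != 0 ->
  contiguous (hA b1 b2) (hB a1 a2 a3)
             (hA b1 (b2 + 1)) (hB (a1 + 1) (a2 + 1) (a3 - 1)).
Proof.
pose k := (1 - a3) * (b1 - a3); rewrite -/k => k0.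
(* [k] and [e] are the values at 1 - a3 of X (X + b1 - 1) and (X + a1) (X + a2). So X + a3 - 1
   divides k (X + a1) (X + a2) - e X (X + b1 - 1), with quotient m1 X + m0, and [p b] is (m1 X + m0)
   (X + b) - 2 k (X + a1) (X + a2). *)
pose e := (a1 - a3 + 1) * (a2 - a3 + 1).
pose m1 := k - e; pose m0 := k * (a1 + a2) - e * (b1 - 1) - m1 * (a3 - 1).
pose p b := quad (m1 - 2 * k) (m0 + b * m1 - 2 * k * (a1 + a2)) (b * m0 - 2 * k * (a1 * a2)).
exists (quad k (k * (b1 - 1)) 0), (p (b2 - 1)),
  (quad e (e * (a1 + a2)) (e * (a1 * a2))),
  (quad k (k * (b1 - 3)) (k * (2 - b1))), (p b2),
  (quad e (e * (a1 + a2 + 2)) (e * (a1 + 1) * (a2 + 1))).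
split; last by split; rewrite ?size_quad // quad_coef2 k0.
all: rewrite /p /m0 /m1 /e /k; poly_identity.
Qed.

Lemma contiguous_a1a2b2_down_a3_up a1 a2 a3 b1 b2 :
    (a1 - 1) * (a2 - 1) - a3 * (a1 + a2 - b1 - 1) != 0 ->
  contiguous (hA b1 b2) (hB a1 a2 a3)
             (hA b1 (b2 - 1)) (hB (a1 - 1) (a2 - 1) (a3 + 1)).
Proof.
pose t := a1 + a2 - b1 - 1; pose v := (a1 - 1) * (a2 - 1).
rewrite -/t -/v; pose r := v - a3 * t; rewrite -/r => r0.
(* [p0] is (r X + l0) (X + b2 - 1) and [p1] is (X + a3) (n0 - r - r X). The constants make X (X + b1
   - 1) (n0 - r X) + (X + a1 - 1) (X + a2 - 1) (r X + l0) a scalar multiple of X + a3, which is what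
   the third identity asks. *)
pose l0 := a3 * (v - (b1 - 1) * t); pose n0 := - r * t - l0.
exists 0, (quad r (l0 + (b2 - 1) * r) ((b2 - 1) * l0)),
  (quad (- r) (n0 - r - a3 * r) (a3 * (n0 - r))), 0,
  (quad r (l0 + (b2 - 2) * r) ((b2 - 2) * l0)),
  (quad (- r) (n0 - (a3 + 1) * r) ((a3 + 1) * n0)).
split; last by split; rewrite ?size_quad ?size_poly0 // !quad_coef2 r0 orbT.
all: rewrite /n0 /l0 /r /t /v; poly_identity.
Qed.

End Contiguity.

(** * Intertwining by Laurent operators in z *)

Definition hyper_op (K F : fieldType) (c : K -> F) (D : F -> F) (z : F)
    (A B : {poly K}) f := pop c D A f - z * pop c D B f.

Definition laurent (K F : fieldType) (c : K -> F) (D : F -> F) (z : F)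
    (pm p0 p1 : {poly K}) f :=
  z^-1 * pop c D pm f + pop c D p0 f + z * pop c D p1 f.

Lemma hyper_op_intertwine (K F : fieldType) (c : {rmorphism K -> F}) (D D' : F -> F)
    (z h : F) (A B : {poly K}) f : (forall g, D' (h * g) = h * D g) ->
  hyper_op c D' z A B (h * f) = h * hyper_op c D z A B f.
Proof. by move=> D'h; rewrite /hyper_op !(pop_intertwine _ _ _ D'h) mulrBr mulrCA. Qed.

Section Intertwining.
Variables (K F : fieldType) (c : {rmorphism K -> F}) (D : F -> F) (z : F).
Hypothesis DD : forall f g, D (f + g) = D f + D g.
Hypothesis DZ : forall a f, D (c a * f) = c a * D f.
Hypothesis Dz : forall f, D (z * f) = z * (D f + f).
Hypothesis z0 : z != 0.

Lemma laurent_intertwines (A B A' B' pm p0 p1 qm q0 q1 : {poly K}) f :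
    shiftp (-1) A' * pm = qm * A ->
    A' * p0 - shiftp (-1) B' * pm = q0 * A - shiftp 1 qm * B ->
    shiftp 1 A' * p1 - B' * p0 = q1 * A - shiftp 1 q0 * B ->
    shiftp 1 B' * p1 = shiftp 1 q1 * B ->
  hyper_op c D z A' B' (laurent c D z pm p0 p1 f) =
  laurent c D z qm q0 q1 (hyper_op c D z A B f).
Proof.
have Dz1 g : D (z * g) = z * (D g + c 1 * g) by rewrite rmorph1 mul1r Dz.
have DzV g : D (z^-1 * g) = z^-1 * (D g + c (-1) * g).
  rewrite rmorphN1; have := Dz (z^-1 * g); rewrite mulVKf // => ->.
  by field.
have popE p q g : pop c D p (pop c D q g) = pop c D (p * q) g by rewrite popM.
have popN p g : pop c D (- p) g = - pop c D p g.
  by rewrite -mulN1r -polyCN popM // popC rmorphN1 mulN1r.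
have popNr p g : pop c D p (- g) = - pop c D p g.
  by rewrite -mulN1r -(rmorphN1 c) popZ // rmorphN1 mulN1r.
have := (fun p g => pop_skew DD DZ p g Dz1, fun p g => pop_skew DD DZ p g DzV).
move=> [skew1 skewV] E1 E2 E3 E4; rewrite /hyper_op /laurent.
(* All powers of z are moved to the left of the operators, where the four relations compare their
   coefficients. *)
rewrite !(popDr DD DZ, popNr, skew1, skewV, popE) E1 -E4.
move/(congr1 (fun p => pop c D p f)): E2; rewrite !popDl !popN => /(canRL (addrK _)) ->.
move/(congr1 (fun p => pop c D p f)): E3; rewrite !popDl !popN => /(canRL (addrK _)) ->.
by field.
Qed.

End Intertwining.

(** * The double covering and the gauge factor *)

Section Pullback.
Variables (K F : fieldType) (c : {rmorphism K -> F}) (d : F -> F) (x : F).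
Hypothesis dD : forall a b, d (a + b) = d a + d b.
Hypothesis dM : forall a b, d (a * b) = d a * b + a * d b.
Hypothesis dc : forall a, d (c a) = 0.
Hypothesis dx : d x = 1.
Hypothesis K0 : [pchar K] =i pred0.
Hypothesis x0 : x != 0.
Hypothesis x1 : 1 - x != 0.
Hypothesis x2 : 2 - x != 0.

(* z pulls the 3F2 equation back to three singular points, its ramification at
   x = 0 and x = 2 doubling the local exponents; [theta s] is z d/dz conjugated
   by (1 - x)^s. *)
Definition zpull := - x ^+ 2 / (4 * (1 - x)).
Definition theta (s : K) f := x * (1 - x) / (2 - x) * d f - c s * (x / (2 - x)) * f.

Lemma natK n : n.+1%:R != 0 :> K.
Proof. by rewrite (proj1 (pcharf0P K) K0). Qed.

Lemma natF n : n.+1%:R != 0 :> F.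
Proof. by rewrite -(rmorph_nat c) fmorph_eq0 natK. Qed.

Lemma zpull_neq0 : zpull != 0.
Proof. by rewrite mulf_neq0 ?oppr_eq0 ?expf_neq0 ?invr_neq0 ?mulf_neq0 ?natF. Qed.

Lemma theta_lead_neq0 : x * (1 - x) / (2 - x) != 0.
Proof. by rewrite !mulf_neq0 ?invr_neq0. Qed.

Lemma pullback_factor_neq0 : 4 * (2 - x) / x != 0.
Proof. by rewrite !mulf_neq0 ?invr_neq0 ?natF. Qed.

Lemma zpull_laurentE a b e : zpull^-1 * a + b + zpull * e =
  (4 * b * x ^+ 2 * (1 - x) - 16 * a * (1 - x) ^+ 2 - e * x ^+ 4)
  / (4 * x ^+ 2 * (1 - x)).
Proof. by have n4 := natF 3; rewrite /zpull; field; rewrite x0 x1 n4 oppr_eq0 expf_neq0. Qed.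

Lemma thetaD s f g : theta s (f + g) = theta s f + theta s g.
Proof. by rewrite /theta dD; ring. Qed.

Lemma thetaZ s a f : theta s (c a * f) = c a * theta s f.
Proof. by rewrite /theta dM dc; ring. Qed.

Let d2 : d 2 = 0.
Proof. by rewrite -(rmorph_nat c) dc. Qed.

Lemma theta_zpull s f : theta s (zpull * f) = zpull * (theta s f + f).
Proof.
have n4 := natF 3.
rewrite /theta /zpull !(dM, derivV dM, derivN dD) ?mulf_neq0 //.
rewrite !(dM, dD, derivN dD, dx, deriv1 dM).
by field; rewrite x1 x2 n4.
Qed.

(** The hypothesis makes [h] behave like (1 - x)^(s - s'), the quotient of the two conjugating
    factors. *)
Lemma theta_gauge s s' h : d h = (c s' - c s) / (1 - x) * h ->
  forall f, theta s' (h * f) = h * theta s f.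
Proof. by move=> dh f; rewrite /theta dM dh; field; rewrite x1 x2. Qed.

(** The power (1 - x)^(s - s') is rational for integral s' - s. Only these three differences occur,
    since s = e7/2 and e7 changes by 0, 2 or -2. *)
Lemma gauge_exists s s' : s' = s \/ s' = s + 1 \/ s' = s - 1 ->
  exists2 h, h != 0 & d h = (c s' - c s) / (1 - x) * h.
Proof.
case=> [->|[->|->]].
- by exists 1; rewrite ?oner_eq0 // (deriv1 dM) subrr !mul0r.
- exists (1 - x)^-1; first by rewrite invr_eq0.
  rewrite (derivV dM) // dD (derivN dD) dx (deriv1 dM) rmorphD rmorph1.
  by field.
- exists (1 - x) => //.
  rewrite dD (derivN dD) dx (deriv1 dM) rmorphB rmorph1.
  by field.
Qed.

(* Here e7 = e5 - e3 and e2 = 3 - e1 - e3 - e5 - 2 e6: the 3F2 parameters are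
   b = (1 - e1/2, 1 - e2/2) and a = (e5 - e7/2, e6 - e7/2, e7/2), and the
   exponent of the gauge factor is s = e7/2. *)
Definition E3b_A (e1 e3 e5 e6 : K) :=
  hA (1 - e1 / 2) (1 - (- e3 - e5 - 2 * e6 + 3 - e1) / 2).
Definition E3b_B (e3 e5 e6 : K) :=
  hB (e5 - (e5 - e3) / 2) (e6 - (e5 - e3) / 2) ((e5 - e3) / 2).

(** The factor 4 (2 - x) / x normalises the leading coefficient: as 1 - z = (2 - x)^2 / (4 (1 - x)),
    that of [hyper_op] is x^3 (1 - x)^2 / (4 (2 - x)). *)
Lemma E3b_pullback e1 e3 e5 e6 f :
  let e2 := - e3 - e5 - 2 * e6 + 3 - e1 in
  let e4 := e3 - e5 + e6 in
  let e7 := 3 - (e1 + e2 + e3 + e4 + e5 + e6) in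
  x ^+ 2 * (x - 1) ^+ 2 * d (d (d f))
  + x * (x - 1) * (c (6 - e1 - e2 - e3 - e4) * x + c (- 3 + e1 + e2)) * d (d f)
  + (c ((e5 + e6 + 1) * e7 + (e6 + 1) * (e5 + 1)) * x ^+ 2
     + c (- (e5 + e6) * e7 - e1 * e2 + e3 * e4 - e5 * e6
             + 2 * e1 + 2 * e2 - 4) * x + c ((e1 - 1) * (e2 - 1))) * d f
  + (c (e5 * e6 * e7) * x + c (A00 e1 e2 e3 e4 e5 e6 e7)) * f
  = 4 * (2 - x) / x *
    hyper_op c (theta ((e5 - e3) / 2)) zpull (E3b_A e1 e3 e5 e6) (E3b_B e3 e5 e6) f.
Proof.
move=> e2 e4 e7.
have -> : e7 = e5 - e3 by rewrite /e7 /e4 /e2; ring.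
have n4 := natF 3; have n2 := natF 1; have n54 := natF 53.
(* Once the inverse of 2 - x has a name with derivative y * y, the product rule alone expands the
   iterates of [theta]. *)
set y := (2 - x)^-1; have yE : y * (2 - x) = 1 by rewrite mulVf.
have dy : d y = y * y.
  rewrite /y (derivV dM) // dD (derivN dD) dx d2; field; exact: x2.
rewrite /hyper_op /E3b_A /E3b_B /hA /hB.
rewrite !(popM (thetaD _) (thetaZ _)) !(popX (thetaD _) (thetaZ _), popXD (thetaD _) (thetaZ _)).
rewrite /theta -/y.
set s := c ((e5 - e3) / 2); have ds : d s = 0 by exact: dc.
rewrite !(dM, dD, derivN dD, ds, dc, dy, dx, deriv0 dD, deriv1 dM).
rewrite /s /zpull /A00 /e4 /e2 /y.
by field; rewrite n2 n4 n54 x0 x1 x2.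
Qed.

Lemma is_dop_theta s n g a : is_dop d n g a ->
  is_dop d n.+1 (fun f => theta s (g f)) (x * (1 - x) / (2 - x) * a).
Proof.
move=> dg; rewrite -[X in is_dop _ _ _ X]addr0.
rewrite -(mulr0 (- (c s * (x / (2 - x))))).
apply: (is_dop_ext (g := fun f => x * (1 - x) / (2 - x) * d (g f)
                                  + - (c s * (x / (2 - x))) * g f)).
  by move=> f; rewrite mulNr.
by apply: is_dopD; apply: is_dopZ; [exact: is_dop_deriv | exact: is_dopS dg].
Qed.

Lemma is_dop_pop s n (p : {poly K}) : (size p <= n.+1)%N ->
  is_dop d n (pop c (theta s) p) ((x * (1 - x) / (2 - x)) ^+ n * c p`_n).
Proof.
move=> sp.
have dopX m : is_dop d m (fun f => iter m (theta s) f) ((x * (1 - x) / (2 - x)) ^+ m).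
  elim: m => [|m IH]; last by rewrite exprS; exact: is_dop_theta.
  by apply: (is_dop_ext (g := fun f => 1 * f)) (is_dop_mul _ _) => f; rewrite mul1r.
apply: (is_dop_ext (g := fun f => \sum_(i < n.+1) c p`_i * iter i (theta s) f)).
  by move=> f; rewrite (pop_wide _ _ _ sp).
elim: n {sp} => [|n IH]; rewrite mulrC.
  apply: (is_dop_ext (g := fun f => c p`_0 * iter 0 (theta s) f)).
    by move=> f; rewrite big_ord1.
  exact: is_dopZ (dopX 0).
apply: (is_dop_ext (g := fun f => \sum_(i < n.+1) c p`_i * iter i (theta s) f
                                  + c p`_n.+1 * iter n.+1 (theta s) f)).
  by move=> f; rewrite [RHS]big_ord_recr.
rewrite -[X in is_dop _ _ _ X]add0r; apply: is_dopD; first exact: is_dopS IH.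
exact: is_dopZ (dopX _).
Qed.

Lemma is_dop_laurent s n (pm p0 p1 : {poly K}) :
    (size pm <= n.+1)%N -> (size p0 <= n.+1)%N -> (size p1 <= n.+1)%N ->
  is_dop d n (laurent c (theta s) zpull pm p0 p1)
    ((x * (1 - x) / (2 - x)) ^+ n *
     (zpull^-1 * c pm`_n + c p0`_n + zpull * c p1`_n)).
Proof.
move=> sm s0 s1; set t := _ ^+ n.
have -> : t * (zpull^-1 * c pm`_n + c p0`_n + zpull * c p1`_n) =
    zpull^-1 * (t * c pm`_n) + t * c p0`_n + zpull * (t * c p1`_n) by ring.
apply: is_dopD; last by apply: is_dopZ; exact: is_dop_pop.
by apply: is_dopD; last exact: is_dop_pop; apply: is_dopZ; exact: is_dop_pop.
Qed.

End Pullback.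

(** * Rational functions of x and the transfer to [E3b] *)

Lemma quotient_ruleD (F : fieldType) (n d n' d' dn dd dn' dd' : F) :
    d != 0 -> d' != 0 ->
  ((dn * d' + n * dd' + (dn' * d + n' * dd)) * (d * d')
    - (n * d' + n' * d) * (dd * d' + d * dd')) / (d * d') ^+ 2 =
  (dn * d - n * dd) / d ^+ 2 + (dn' * d' - n' * dd') / d' ^+ 2.
Proof. by move=> d0 d'0; field; rewrite d0 d'0. Qed.

(** As in the rule for sums, the derivatives are independent variables, so that [field] applies
    before polynomials are substituted. *)
Lemma quotient_ruleM (F : fieldType) (n d n' d' dn dd dn' dd' : F) :
    d != 0 -> d' != 0 ->
  ((dn * n' + n * dn') * (d * d') - n * n' * (dd * d' + d * dd')) / (d * d') ^+ 2 =
  (dn * d - n * dd) / d ^+ 2 * (n' / d') + n / d * ((dn' * d' - n' * dd') / d' ^+ 2).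
Proof. by move=> d0 d'0; field; rewrite d0 d'0. Qed.

Section RationalFunctions.
Variable K : fieldType.
Local Notation F := {fraction {poly K}}.
Local Notation x := ('X%:F : F).

Lemma fracP (f : F) : exists n d : {poly K}, d != 0 /\ f = n%:F / d%:F.
Proof.
have d0 : \d_(repr f) != 0 by exact: denom_ratioP.
exists \n_(repr f), \d_(repr f); split=> //.
rewrite -[LHS]reprK -[repr f in LHS]Ratio_numden.
move: (\n_(repr f)) (\d_(repr f)) d0 => a b b0.
apply/(mulIf (x := b%:F)); first by rewrite tofrac_eq0.
rewrite divfK ?tofrac_eq0 //; unlock FracField.tofrac.
rewrite -[LHS]FracField.pi_mul; apply/eqmodP => /=.
by rewrite FracField.equivfE /FracField.mulf !numden_Ratio ?oner_neq0 ?mulr1 // mulrC.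
Qed.

Definition cst : {rmorphism K -> F} := @FracField.tofrac {poly K} \o polyC.

Lemma fderivD (f g : F) : fderiv (f + g) = fderiv f + fderiv g.
Proof.
have [n [d [d0 ->]]] := fracP f; have [n' [d' [d'0 ->]]] := fracP g.
have dd'0 := mulf_neq0 d0 d'0.
have D0 : d%:F != 0 :> F by rewrite tofrac_eq0.
have D'0 : d'%:F != 0 :> F by rewrite tofrac_eq0.
have -> : n%:F / d%:F + n'%:F / d'%:F = (n * d' + n' * d)%:F / (d * d')%:F :> F.
  by rewrite (addf_div _ _ D0 D'0) tofracD 3!tofracM.
rewrite (fderivE _ dd'0) (fderivE _ d0) (fderivE _ d'0) !(derivM, derivD)
  !(tofracXn, tofracB, tofracM, tofracD).
exact (@quotient_ruleD F n%:F d%:F n'%:F d'%:F n^`()%:F d^`()%:F n'^`()%:F d'^`()%:F D0 D'0).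
Qed.

Lemma fderivM (f g : F) : fderiv (f * g) = fderiv f * g + f * fderiv g.
Proof.
have [n [d [d0 ->]]] := fracP f; have [n' [d' [d'0 ->]]] := fracP g.
have dd'0 := mulf_neq0 d0 d'0.
have D0 : d%:F != 0 :> F by rewrite tofrac_eq0.
have D'0 : d'%:F != 0 :> F by rewrite tofrac_eq0.
have -> : n%:F / d%:F * (n'%:F / d'%:F) = (n * n')%:F / (d * d')%:F :> F.
  by rewrite mulf_div 2!tofracM.
rewrite (fderivE _ dd'0) (fderivE _ d0) (fderivE _ d'0) !derivM
  !(tofracXn, tofracB, tofracM, tofracD).
exact (@quotient_ruleM F n%:F d%:F n'%:F d'%:F n^`()%:F d^`()%:F n'^`()%:F d'^`()%:F D0 D'0).
Qed.

Lemma fderiv_poly (p : {poly K}) : fderiv p%:F = (p^`())%:F :> F.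
Proof.
rewrite -[p%:F]divr1 -tofrac1 (fderivE _ (oner_neq0 _)).
by rewrite derivC mulr1 mulr0 subr0 expr1n tofrac1 divr1.
Qed.

Lemma fderiv_cst a : fderiv (cst a) = 0.
Proof. by rewrite /= fderiv_poly derivC tofrac0. Qed.

Lemma fderivX : fderiv x = 1.
Proof. by rewrite fderiv_poly derivX tofrac1. Qed.

Hypothesis K0 : [pchar K] =i pred0.

Lemma pchar_frac : [pchar F] =i pred0.
Proof.
by apply/pcharf0P => n; rewrite -(rmorph_nat cst) fmorph_eq0 (proj1 (pcharf0P K) K0).
Qed.

Lemma fracX_neq0 : x != 0.
Proof. by rewrite tofrac_eq0 polyX_eq0. Qed.

Lemma subr_fracX_neq0 a : cst a - x != 0.
Proof.
by rewrite /= -tofracB tofrac_eq0 subr_eq0 eq_sym -subr_eq0 polyXsubC_eq0.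
Qed.

Lemma dapp_E3 (e1 e2 e3 e4 e5 e6 e7 : K) f :
  dapp (@fderiv K) (E3 e1 e2 e3 e4 e5 e6 e7) f =
  x ^+ 2 * (x - 1) ^+ 2 * fderiv (fderiv (fderiv f))
  + x * (x - 1) * (cst (6 - e1 - e2 - e3 - e4) * x + cst (- 3 + e1 + e2)) * fderiv (fderiv f)
  + (cst ((e5 + e6 + 1) * e7 + (e6 + 1) * (e5 + 1)) * x ^+ 2
     + cst (- (e5 + e6) * e7 - e1 * e2 + e3 * e4 - e5 * e6
             + 2 * e1 + 2 * e2 - 4) * x + cst ((e1 - 1) * (e2 - 1))) * fderiv f
  + (cst (e5 * e6 * e7) * x + cst (A00 e1 e2 e3 e4 e5 e6 e7)) * f.
Proof.
by rewrite /E3 !dappDl !dappZl dappC !dapp_Xn dappX.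
Qed.

(** Multiplied by 4 x^2 (1 - x), the expression is a polynomial whose coefficients of degree 0, 2
    and 4 can vanish only if a, b and e vanish in turn. *)
Lemma zpull_transcendental a b e : [|| a != 0, b != 0 | e != 0] ->
  (zpull x)^-1 * cst a + cst b + zpull x * cst e != 0.
Proof.
move=> abe.
have n4 : 4 != 0 :> F by rewrite (proj1 (pcharf0P F) pchar_frac).
have x0 := fracX_neq0; have x1 : 1 - x != 0.
  by have := subr_fracX_neq0 1; rewrite rmorph1.
pose p : {poly K} := Poly [:: - (16 * a); 32 * a; 4 * b - 16 * a; - (4 * b); - e].
have -> : (zpull x)^-1 * cst a + cst b + zpull x * cst e =
    p%:F / (4 * x ^+ 2 * (1 - x)).
  rewrite (zpull_laurentE cst K0 x0 x1); congr (_ / _).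
  have -> : p = (4 * b)%:P * 'X ^+ 2 * (1 - 'X) - (16 * a)%:P * (1 - 'X) ^+ 2
                - e%:P * 'X ^+ 4.
    by rewrite /p /= !cons_poly_def; ring.
  have cM n y : ((n%:R * y)%:P)%:F = n%:R * cst y.
    by rewrite -(rmorph_nat cst) -rmorphM.
  rewrite 2!tofracB (tofracM (_ * _)) !(tofracM _%:P) !tofracXn tofracB tofrac1.
  by rewrite !cM.
have den0 : 4 * x ^+ 2 * (1 - x) != 0.
  by apply: mulf_neq0 x1; apply: mulf_neq0 n4 _; exact: expf_neq0 x0.
rewrite mulf_eq0 invr_eq0 (negPf den0) orbF tofrac_eq0.
apply: contraTneq abe => p0.
have pE i : p`_i = 0 by rewrite p0 coef0.
have a0 : a = 0.
  have /eqP := pE 0%N; rewrite coef_Poly /= oppr_eq0 mulf_eq0.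
  by rewrite (proj1 (pcharf0P K) K0) => /eqP.
have b0 : b = 0.
  have /eqP := pE 2; rewrite coef_Poly /= a0 mulr0 subr0 mulf_eq0.
  by rewrite (proj1 (pcharf0P K) K0) => /eqP.
have e0 : e = 0.
  by have /eqP := pE 4; rewrite coef_Poly /= oppr_eq0 => /eqP.
by rewrite a0 b0 e0 eqxx.
Qed.

Lemma dapp_E3b e1 e3 e5 e6 f : dapp (@fderiv K) (E3b e1 e3 e5 e6) f =
  4 * (2 - x) / x *
  hyper_op cst (theta cst (@fderiv K) x ((e5 - e3) / 2)) (zpull x)
    (E3b_A e1 e3 e5 e6) (E3b_B e3 e5 e6) f.
Proof.
have x1 := subr_fracX_neq0 1; have x2 := subr_fracX_neq0 2.
rewrite rmorph1 in x1; rewrite rmorph_nat in x2.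
rewrite -(E3b_pullback fderivD fderivM fderiv_cst fderivX K0 fracX_neq0 x1 x2).
exact: dapp_E3.
Qed.

(** Let H, H' be the hypergeometric operators at the exponent s, L and M the Laurent operators of
    the p's and q's, and w = 4 (2 - x) / x. Then E' h L = w h H' L = w h M H = (w h M w^-1) E, so P
    = h L and Q = w h M w^-1. *)
Lemma shift_of_contiguous (e1 e3 e5 e6 e1' e3' e5' e6' : K) :
    contiguous (E3b_A e1 e3 e5 e6) (E3b_B e3 e5 e6)
               (E3b_A e1' e3' e5' e6') (E3b_B e3' e5' e6') ->
    (let s := (e5 - e3) / 2 in let s' := (e5' - e3') / 2 in
     s' = s \/ s' = s + 1 \/ s' = s - 1) ->
  exists P, is_shift_operator (E3b e1 e3 e5 e6) (E3b e1' e3' e5' e6') P.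
Proof.
move=> [pm [p0 [p1 [qm [q0 [q1 [E1 E2 E3 E4 [spm sp0 sp1 lead]]]]]]]] /= ss'.
have dD := fderivD; have dM := fderivM.
move: (dapp_E3b e1 e3 e5 e6) (dapp_E3b e1' e3' e5' e6').
move: (E3b e1 e3 e5 e6) (E3b e1' e3' e5' e6') => E E' EE EE'.
have x0 := fracX_neq0; have x1 : 1 - x != 0.
  by have := subr_fracX_neq0 1; rewrite rmorph1.
have x2 : 2 - x != 0 by have := subr_fracX_neq0 2; rewrite rmorph_nat.
have [h h0 dh] := gauge_exists cst dD dM fderivX x1 ss'.
have [P [sP P2 dP]] :=
  is_dopZ h (is_dop_laurent cst x dD dM ((e5 - e3) / 2) spm sp0 sp1).
(* A crude bound suffices: the order of Q is unrestricted. *)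
pose n := (size qm + size q0 + size q1)%N.
have [||| Q0 [_ _ dQ0]] :=
  is_dop_laurent cst x dD dM ((e5 - e3) / 2) (n := n) (pm := qm) (p0 := q0) (p1 := q1).
- by rewrite /n -addnA leqW // leq_addr.
- by rewrite /n addnAC leqW // leq_addl.
- by rewrite /n leqW // leq_addl.
pose w : F := 4 * (2 - x) / x.
have w0 : w != 0 := pullback_factor_neq0 cst K0 x0 x2.
exists P; split; [|exact: sP|].
  have : P`_2 != 0.
    rewrite P2; apply: mulf_neq0 h0 _; apply: mulf_neq0.
      exact: expf_neq0 (theta_lead_neq0 x0 x1 x2).
    exact: zpull_transcendental lead.
  by apply: contraNneq => ->; rewrite coef0.
exists (dcomp (@fderiv K) ((w * h) *: Q0) (w^-1)%:P).
apply: (dapp_inj dD dM fderivX pchar_frac) => f.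
rewrite (dapp_comp E' P f dD dM) (dapp_comp _ E f dD dM).
rewrite (dapp_comp _ (w^-1)%:P _ dD dM) EE EE'.
rewrite dappC dappZl dP dQ0 -/w (mulKf w0).
rewrite (hyper_op_intertwine _ _ _ _ _ (theta_gauge dM x1 x2 dh)) mulrA.
congr (_ * _); apply: laurent_intertwines.
- exact: thetaD.
- exact: thetaZ fderivM fderiv_cst _.
- move=> g. exact (theta_zpull cst fderivD fderivM fderivX K0 x1 x2 ((e5 - e3) / 2) g).
- exact (zpull_neq0 cst K0 x0 x1).
- exact: E1.
- exact: E2.
- exact: E3.
- exact: E4.
Qed.

End RationalFunctions.

(** * The eight shifts in hypergeometric parameters *)

Section Shifts.
Variable K : fieldType.
Hypothesis K0 : [pchar K] =i pred0.
Implicit Types e : K.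

Let two_neq0 : 2 != 0 :> K.
Proof. by rewrite (proj1 (pcharf0P K) K0). Qed.

Let half_neq0 (k : K) : k != 0 -> k / 2 != 0.
Proof. by move=> k0; rewrite mulf_neq0 ?invr_eq0. Qed.

Definition has_shift e1 e3 e5 e6 (n1 n3 n5 n6 : int) :=
  exists P, is_shift_operator (E3b e1 e3 e5 e6)
    (E3b (e1 + n1%:~R) (e3 + n3%:~R) (e5 + n5%:~R) (e6 + n6%:~R)) P.

Lemma hA_sym (b1 b2 : K) : hA b1 b2 = hA b2 b1.
Proof. by rewrite /hA mulrAC. Qed.

Lemma hB_sym (a1 a2 a3 : K) : hB a1 a2 a3 = hB a1 a3 a2.
Proof. by rewrite /hB mulrAC. Qed.

(** [A'] and [B'] are left free so that the a's or the b's can be permuted first. The last condition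
    says that e7/2 = (e5 - e3)/2 moves by 0, 1 or -1, as the gauge factor requires. *)
Lemma has_shift_contiguous e1 e3 e5 e6 (n1 n3 n5 n6 : int) (A' B' : {poly K}) :
    contiguous (E3b_A e1 e3 e5 e6) (E3b_B e3 e5 e6) A' B' ->
    E3b_A (e1 + n1%:~R) (e3 + n3%:~R) (e5 + n5%:~R) (e6 + n6%:~R) = A' ->
    E3b_B (e3 + n3%:~R) (e5 + n5%:~R) (e6 + n6%:~R) = B' ->
    n5 - n3 \in [:: 0; 2; -2] ->
  has_shift e1 e3 e5 e6 n1 n3 n5 n6.
Proof.
move=> AB AE BE n53; apply: shift_of_contiguous => //; first by rewrite AE BE.
have -> : (e5 + n5%:~R - (e3 + n3%:~R)) / 2 = (e5 - e3) / 2 + (n5 - n3)%:~R / 2 :> K.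
  by rewrite rmorphB; ring.
move: n53; rewrite !inE => /or3P[] /eqP ->.
- by left; rewrite mul0r addr0.
- by right; left; rewrite divff.
- by right; right; rewrite mulNr divff.
Qed.

(** As e2 drops by 2, b1 goes down and b2 up by 1; the condition reads b1 - b2 - 1 != 0. *)
Lemma has_shift_e1_up e1 e3 e5 e6 : 1 - 2 * e1 - e3 - e5 - 2 * e6 != 0 ->
  has_shift e1 e3 e5 e6 2 0 0 0.
Proof.
move=> ne0; apply: has_shift_contiguous (contiguous_b1_down_b2_up _ _ _ _) _ _ _.
- have -> : 1 - e1 / 2 - (1 - (- e3 - e5 - 2 * e6 + 3 - e1) / 2) - 1 =
    (1 - 2 * e1 - e3 - e5 - 2 * e6) / 2 by field.
  exact: half_neq0.
- by congr (hA _ _); field.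
- by congr (hB _ _ _); field.
- by [].
Qed.

Lemma has_shift_e1_down e1 e3 e5 e6 : 5 - 2 * e1 - e3 - e5 - 2 * e6 != 0 ->
  has_shift e1 e3 e5 e6 (- 2) 0 0 0.
Proof.
move=> ne0; eapply has_shift_contiguous.
(* Exchanging b1 and b2 reduces the opposite shift to the same relation. *)
- rewrite /E3b_A hA_sym; apply: contiguous_b1_down_b2_up.
  have -> : 1 - (- e3 - e5 - 2 * e6 + 3 - e1) / 2 - (1 - e1 / 2) - 1 =
    - ((5 - 2 * e1 - e3 - e5 - 2 * e6) / 2) by field.
  by rewrite oppr_eq0 half_neq0.
- by rewrite /E3b_A hA_sym; congr (hA _ _); field.
- by congr (hB _ _ _); field.
- by [].
Qed.

(** Both e2 and e7 drop by 2, so a1, a2, b2 go up and a3 goes down by 1. *)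
Lemma has_shift_e3_up e1 e3 e5 e6 : (2 - e5 + e3) * (2 - e1 - e5 + e3) != 0 ->
  has_shift e1 e3 e5 e6 0 2 0 0.
Proof.
move=> ne0; apply: has_shift_contiguous (contiguous_a1a2b2_up_a3_down _ _ _ _) _ _ _.
- have -> : (1 - (e5 - e3) / 2) * (1 - e1 / 2 - (e5 - e3) / 2) =
    (2 - e5 + e3) * (2 - e1 - e5 + e3) / 2 / 2 by field.
  exact: half_neq0 (half_neq0 ne0).
- by congr (hA _ _); field.
- by congr (hB _ _ _); field.
- by [].
Qed.

Lemma has_shift_e3_down e1 e3 e5 e6 :
    (e5 + e3 - 2) * (2 * e6 - e5 + e3 - 2) - (e5 - e3) * (2 * e3 + 2 * e6 + e1 - 4) != 0 ->
  has_shift e1 e3 e5 e6 0 (- 2) 0 0.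
Proof.
move=> ne0; apply: has_shift_contiguous (contiguous_a1a2b2_down_a3_up _ _) _ _ _.
- set k := (X in X != 0); have -> : k =
    ((e5 + e3 - 2) * (2 * e6 - e5 + e3 - 2) - (e5 - e3) * (2 * e3 + 2 * e6 + e1 - 4)) / 2 / 2.
    by rewrite /k; field.
  exact: half_neq0 (half_neq0 ne0).
- by congr (hA _ _); field.
- by congr (hB _ _ _); field.
- by [].
Qed.

Lemma has_shift_e5_up e1 e3 e5 e6 :
    (2 - 2 * e6 + e5 - e3) * (2 - e1 - 2 * e6 + e5 - e3) != 0 ->
  has_shift e1 e3 e5 e6 0 0 2 0.
Proof.
move=> ne0; eapply has_shift_contiguous.
(* Raising e5 moves a1, a3, b2 up and a2 down: the pattern of e3 with a2 and a3 exchanged. *)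
- rewrite /E3b_B hB_sym; apply: contiguous_a1a2b2_up_a3_down.
  set k := (X in X != 0); have -> : k =
    (2 - 2 * e6 + e5 - e3) * (2 - e1 - 2 * e6 + e5 - e3) / 2 / 2 by rewrite /k; field.
  exact: half_neq0 (half_neq0 ne0).
- by congr (hA _ _); field.
- by rewrite /E3b_B hB_sym; congr (hB _ _ _); field.
- by [].
Qed.

Lemma has_shift_e5_down e1 e3 e5 e6 :
    (e5 + e3 - 2) * (e5 - e3 - 2) - (2 * e6 - e5 + e3) * (2 * e5 + e1 - 4) != 0 ->
  has_shift e1 e3 e5 e6 0 0 (- 2) 0.
Proof.
move=> ne0; eapply has_shift_contiguous.
- rewrite /E3b_B hB_sym; apply: contiguous_a1a2b2_down_a3_up.
  set k := (X in X != 0); have -> : k =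
    ((e5 + e3 - 2) * (e5 - e3 - 2) - (2 * e6 - e5 + e3) * (2 * e5 + e1 - 4)) / 2 / 2.
    by rewrite /k; field.
  exact: half_neq0 (half_neq0 ne0).
- by congr (hA _ _); field.
- by rewrite /E3b_B hB_sym; congr (hB _ _ _); field.
- by [].
Qed.

(** Only a2 = e6 - e7/2 and b2 = 1 - e2/2 move, both up by 1, because e2 contains - 2 e6; hence the
    unit step. *)
Lemma has_shift_e6_up e1 e3 e5 e6 : has_shift e1 e3 e5 e6 0 0 0 1.
Proof.
apply: has_shift_contiguous (contiguous_a2b2_up _ _ _ _ _) _ _ _.
- by congr (hA _ _); field.
- by congr (hB _ _ _); field.
- by [].
Qed.

Lemma has_shift_e6_down e1 e3 e5 e6 : has_shift e1 e3 e5 e6 0 0 0 (- 1).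
Proof.
apply: has_shift_contiguous (contiguous_a2b2_down _ _ _ _ _) _ _ _.
- by congr (hA _ _); field.
- by congr (hB _ _ _); field.
- by [].
Qed.

End Shifts.

(** * Indeterminate parameters *)

Section ParamField.
Variable R : realType.
Local Notation K := (param_field R).

Lemma param_pchar0 : [pchar K] =i pred0.
Proof.
apply/pcharf0P => n.
by rewrite -(rmorph_nat (@FracField.tofrac {mpoly R[i][4]})) tofrac_eq0
           -(rmorph_nat (@mpolyC 4 R[i])) mpolyC_eq0 Num.Theory.pnatr_eq0.
Qed.

(** Evaluation at the origin detects non-vanishing here, each genericity condition having a positive
    integer as constant term. *)
Lemma param_neq0 (q : {mpoly R[i][4]}) n (y : K) :
  q.@[fun=> 0] = n.+1%:R -> y = q%:F -> y != 0.
Proof.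
move=> qn ->; rewrite tofrac_eq0; apply/eqP => q0.
by have /eqP := qn; rewrite q0 meval0 eq_sym Num.Theory.pnatr_eq0.
Qed.

End ParamField.

Ltac solve_param_neq0 q n :=
  apply: (param_neq0 (q := q) (n := n));
  [ rewrite !(mevalB, mevalD, mevalM, mevalXU, mevalMn, meval1); ring
  | by rewrite !(tofracB, tofracD, tofracM, tofracMn, tofrac1)].

(* The arguments of E3b are (e1, e3, e5, e6), in this order. *)
Theorem theorem5p5 (R : realType) :
  (admits_shift R E3b 2 0 0 0 /\ admits_shift R E3b (- 2) 0 0 0) /\
  (admits_shift R E3b 0 2 0 0 /\ admits_shift R E3b 0 (- 2) 0 0) /\
  (admits_shift R E3b 0 0 2 0 /\ admits_shift R E3b 0 0 (- 2) 0) /\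
  (admits_shift R E3b 0 0 0 1 /\ admits_shift R E3b 0 0 0 (- 1)).
Proof.
have K0 := param_pchar0 R.
pose y k : {mpoly R[i][4]} := 'X_(inord k : 'I_4).
pose y1 := y 0%N; pose y3 := y 1%N; pose y5 := y 2; pose y6 := y 3.
do !split.
- apply: (has_shift_e1_up K0).
  (* The last argument is one less than the constant term of the polynomial, here and below. *)
  solve_param_neq0 (1 - 2 * y1 - y3 - y5 - 2 * y6) 0%N.
- apply: (has_shift_e1_down K0).
  solve_param_neq0 (5 - 2 * y1 - y3 - y5 - 2 * y6) 4%N.
- apply: (has_shift_e3_up K0).
  solve_param_neq0 ((2 - y5 + y3) * (2 - y1 - y5 + y3)) 3%N.
- apply: (has_shift_e3_down K0).
  solve_param_neq0 ((y5 + y3 - 2) * (2 * y6 - y5 + y3 - 2)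
              - (y5 - y3) * (2 * y3 + 2 * y6 + y1 - 4)) 3%N.
- apply: (has_shift_e5_up K0).
  solve_param_neq0 ((2 - 2 * y6 + y5 - y3) * (2 - y1 - 2 * y6 + y5 - y3)) 3%N.
- apply: (has_shift_e5_down K0).
  solve_param_neq0 ((y5 + y3 - 2) * (y5 - y3 - 2)
              - (2 * y6 - y5 + y3) * (2 * y5 + y1 - 4)) 3%N.
- exact: (has_shift_e6_up K0).
- exact: (has_shift_e6_down K0).
Qed.
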